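(* Let $X$ be a Peano continuum. Suppose there is a subset $A\subset X$ with nonempty interior in $X$ such that $A$ (with the subspace topology) is a self regenerating fractal. Then $X$ is an underlying space of some topological fractal, i.e. there exists a finite family $\mathcal{G}$ of continuous self-maps of $X$ such that $(X,\mathcal{G})$ is a topological fractal.
   Context: A Peano continuum is a (nonempty) compact, connected, metrizable, locally connected space. A self-map on $X$ is a function $X\to X$. Compact spaces are assumed Hausdorff. A finite family $\mathcal{F}$ of continuous self-maps on a Hausdorff space $X$ is a topologically contracting system on $Y\subset X$ if for every open cover $\mathcal{U}$ of $Y$ there is an integer $n\ge 0$ such that for all $f_1,\dots,f_n\in\mathcal{F}$ the image $f_1\circ\dots\circ f_n(Y)$ is contained in some $U\in\mathcal{U}$ (for $n=0$ the composition is the identity). A pair $(X,\mathcal{F})$ is a topological fractal if $X$ is a compact space, $\mathcal{F}$ is a topologically contracting system on $X$, and $X=\bigcup_{f\in\mathcal{F}}f(X)$. Then $X$ is called an underlying space of the topological fractal. A Hausdorff topological space $A$ is a self regenerating fractal if for every nonempty open set $U\subset A$ there is a family $\mathcal{F}$ of continuous self-maps on $A$, each constant on $A\setminus U$, such that $(A,\mathcal{F})$ is a topological fractal. *)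

(* Defs.v *)
From mathcomp Require Import all_boot all_order all_algebra.
From mathcomp Require Import all_classical all_reals all_analysis.
Set Implicit Arguments.
Unset Strict Implicit.
Unset Printing Implicit Defensive.
Import Order.TTheory GRing.Theory Num.Theory.
Local Open Scope classical_set_scope.
Local Open Scope ring_scope.

Definition metrizable (R : realType) (T : topologicalType) : Prop :=
  exists d : T -> T -> R,
    [/\ forall x y, d x y = 0 <-> x = y,
        forall x y, d x y = d y x,
        forall x y z, d x z <= d x y + d y z
      & forall (x : T) (B : set T),
          nbhs x B <-> exists2 e : R, 0 < e & [set y | d x y < e] `<=` B].

Definition locally_connected (T : topologicalType) : Prop :=
  basis [set U : set T | open U /\ connected U].

(* Compact spaces are Hausdorff by convention. *)
Definition compact_space (T : topologicalType) : Prop :=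
  hausdorff_space T /\ compact [set: T].

Definition Peano_continuum (R : realType) (T : topologicalType) : Prop :=
  [/\ [set: T] !=set0, compact_space T, connected [set: T],
      metrizable R T & locally_connected T].

(* [\big[comp/idfun]_(i < n) f i] is the composite f_0 \o ... \o f_(n-1),
   which is the identity for n = 0. *)
Definition topologically_contracting (T : topologicalType)
    (F : set (T -> T)) (Y : set T) : Prop :=
  [/\ hausdorff_space T, finite_set F, forall f, F f -> continuous f
    & forall C : set (set T),
        (forall V, C V -> open V) -> Y `<=` \bigcup_(V in C) V ->
        exists n : nat, forall f : 'I_n -> T -> T, (forall i, F (f i)) ->
          exists2 V, C V & (\big[comp/idfun]_(i < n) f i) @` Y `<=` V].

Definition topological_fractal (T : topologicalType) (F : set (T -> T)) : Prop :=
  [/\ compact_space T, topologically_contracting F [set: T]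
    & [set: T] = \bigcup_(f in F) (f @` [set: T])].

Definition underlying_space_of_topological_fractal (T : topologicalType) : Prop :=
  exists G : set (T -> T), topological_fractal G.

Definition constant_on (T T' : Type) (f : T -> T') (B : set T) : Prop :=
  forall x y, B x -> B y -> f x = f y.

Definition self_regenerating_fractal (T : topologicalType) : Prop :=
  hausdorff_space T /\
  forall U : set T, open U -> U !=set0 ->
    exists2 F : set (T -> T),
      forall f, F f -> constant_on f (~` U) & topological_fractal F.

(* Main.v *)
Require Import Defs.
From HB Require Import structures.
From mathcomp Require Import all_boot all_order all_algebra.
From mathcomp Require Import all_classical all_reals all_analysis.
From mathcomp Require Import lra zify.
Set Implicit Arguments.
Unset Strict Implicit.
Unset Printing Implicit Defensive.
Import Order.TTheory GRing.Theory Num.Theory.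
Import numFieldNormedType.Exports.
Local Open Scope classical_set_scope.
Local Open Scope ring_scope.

(** Choose a ball [U] inside [A], with [A `\` U] nonempty, and a fractal
    structure on [A] whose maps are constant off [U]; extend these maps to [X]
    by constants off [A]. By Hahn-Mazurkiewicz there is a surjection
    [g : [0, 1] -> X]; cut it into arcs so small that every arc meeting the
    complement of [A] misses [U]. Composing those arcs with a map [u : X -> [0, 1]]
    that is onto and vanishes off [U] gives finitely many maps, constant off [U],
    which cover the complement of [A] and take no value in [U]. A map constant
    off [U] composed after one of these is constant, so a nonconstant word can
    use them only in its first letter, and the rest of the word is contracted by
    the fractal structure of [A].

    The surjection is built from ever finer finite chains of small connected
    sets: each link of a chain is connected, hence is covered by a chain of
    smaller sets whose vertices stay inside the link and which joins the two
    ends of the link. *)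

Lemma compact_finite_nbhs_cover (X : topologicalType) (N : X -> set X) :
  compact [set: X] -> (forall x, nbhs x (N x)) ->
  exists s : seq X, forall z, exists2 x, x \in s & N x z.
Proof.
move=> cX nN; have [[x0 _]|X0] := pselect ([set: X] !=set0); last first.
  by exists [::] => z; exfalso; apply: X0; exists z.
(* The point [x0] gives [X] the pointed structure under which the covering form of compactness is
   used. *)
pose Xp : ptopologicalType := HB.pack X (isPointed.Build X x0).
have cXp : @compact Xp [set: Xp] by exact: cX.
have := cXp; rewrite compact_cover => /(_ X setT (fun x => (N x)°)) [].
- by move=> x _; exact: open_interior.
- by move=> x _; exists x => //; apply: nN.
move=> D _ Dc; exists (finmap.enum_fset D) => z.
by have [x xD /interior_subset Nz] := Dc z I; exists x.
Qed.

(** * The Hahn-Mazurkiewicz theorem *)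

Section MetricPeano.
Context (R : realType) (X : topologicalType) (d : X -> X -> R)
  (d0 : forall x y, d x y = 0 <-> x = y)
  (dC : forall x y, d x y = d y x)
  (dD : forall x y z, d x z <= d x y + d y z)
  (dN : forall (x : X) (B : set X),
          nbhs x B <-> exists2 e : R, 0 < e & [set y | d x y < e] `<=` B).

(** * Elementary facts about the metric and the scales [eps n] *)

Lemma metric_ge0 x y : 0 <= d x y.
Proof.
have := dD x y x; rewrite (dC y x) (d0 x x).2 // => ?; lra.
Qed.

Lemma metric_refl x : d x x = 0.
Proof. exact/d0. Qed.

Lemma nbhs_metric_ball x e : 0 < e -> nbhs x [set y | d x y < e].
Proof. by move=> e0; apply/dN; exists e. Qed.

Lemma metric_small_eq x y : (forall e, 0 < e -> d x y <= e) -> x = y.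
Proof.
move=> h; apply/d0/eqP; rewrite eq_le metric_ge0 andbT.
by apply/ler_addgt0Pr => e e0; rewrite add0r h.
Qed.

Lemma metric_continuous (x0 : X) : continuous (fun x => d x0 x : R^o).
Proof.
move=> x; apply/cvgrPdist_lt => e e0; near=> y.
have dxy : d x y < e by near: y; exact: nbhs_metric_ball.
rewrite ltr_norml; have := dD x0 x y; have := dD x0 y x.
by rewrite (dC y x) => ? ?; apply/andP; split; lra.
Unshelve. all: by end_near. Qed.

Definition eps (n : nat) : R := 2^-1 ^+ n.

Lemma eps_gt0 n : 0 < eps n.
Proof. by rewrite exprn_gt0 // invr_gt0. Qed.

Lemma epsS n : eps n = 2 * eps n.+1.
Proof. by rewrite /eps exprS mulrA divff ?mul1r // pnatr_eq0. Qed.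

Lemma eps_small e : 0 < e -> exists n, eps n < e.
Proof.
move=> e0; have h : (2^-1 ^+ n : R) @[n --> \oo] --> 0.
  by apply: cvg_expr; rewrite ger0_norm ?invr_ge0 // invf_lt1 ?ltr1n.
move/cvgrPdist_lt : h => /(_ e e0) [n _ /(_ n (leqnn n))] /=.
by rewrite sub0r normrN ger0_norm ?(ltW (eps_gt0 n)) // => ?; exists n.
Qed.

(** A cluster point, given by compactness, serves as [l]. The steps from the n-th term onwards sum
    to at most [2 * eps n], and one more [eps n] leads from a late term to [l]. *)
Lemma metric_geometric_cvg (x : nat -> X) : compact [set: X] ->
  (forall n, d (x n) (x n.+1) <= eps n) ->
  exists l, forall n, d (x n) l <= 3 * eps n.
Proof.
move=> cX dx; have [l [_ cl]] := cX (x @ \oo) _ filterT; exists l => n.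
(* Subtracting [2 * eps (n + m)] keeps the geometric sum exact, so that the induction closes. *)
have tail m : d (x n) (x (n + m)%N) <= 2 * eps n - 2 * eps (n + m)%N.
  elim: m => [|m IH]; first by rewrite addn0 metric_refl subrr.
  rewrite addnS; have := dD (x n) (x (n + m)%N) (x (n + m).+1).
  have := dx (n + m)%N; have := epsS (n + m); lra.
have [|_ [[m nm <-] /= dlx]] :=
    cl (x @` [set m | (n <= m)%N]) _ _ (nbhs_metric_ball l (eps_gt0 n)).
  by exists n => // m /= nm; exists m.
have := dD (x n) (x m) l; have := tail (m - n)%N; rewrite subnKC // (dC (x m) l).
have := eps_gt0 m; move: dlx; lra.
Qed.

(** * Chains of small connected sets *)

Definition small_link (e : R) (V : set X) (a b : X) :=
  [/\ connected V, forall u v, V u -> V v -> d u v < e, V a & V b].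

(** Only the [m.+1] vertices are held inside [P]; the [m] links may stick out of it. [W] records
    what the links cover. *)
Definition chain (e : R) (P : set X) (m : nat) (p q : X) (W : set X) :=
  exists (y : nat -> X) (V : nat -> set X),
    [/\ y 0%N = p, y m = q, forall j, (j < m)%N -> small_link e (V j) (y j) (y j.+1),
      forall j, (j <= m)%N -> P (y j) & W `<=` \bigcup_(j in `I_m) V j].

Section Chains.
Context (cX : compact [set: X]) (lX : locally_connected X).

Lemma small_nbhs (e : R) x : 0 < e -> exists2 N : set X, open N /\ N x &
  connected N /\ forall u v, N u -> N v -> d u v < e.
Proof.
move=> e0; have e20 : 0 < e / 2 by lra.
have [_ /(_ x)/(_ _ (nbhs_metric_ball x e20)) [N [[oN cN] Nx] /= NB]] := lX.
exists N => //; split=> // u v /NB/= du /NB/= dv.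
by have := dD u x v; rewrite (dC u x); lra.
Qed.

Lemma small_nbhs_family (e : R) : 0 < e ->
  exists2 N : X -> set X, forall x, open (N x) /\ N x x &
    forall x, connected (N x) /\ forall u v, N x u -> N x v -> d u v < e.
Proof.
move=> e0.
have /choice[N hN] x : exists N, (open N /\ N x) /\
    (connected N /\ forall u v, N u -> N v -> d u v < e).
  by have [N ? ?] := small_nbhs x e0; exists N.
by exists N => x; have [] := hN x.
Qed.

Lemma chain_cat e P m1 m2 p q r W1 W2 :
  chain e P m1 p q W1 -> chain e P m2 q r W2 ->
  chain e P (m1 + m2) p r (W1 `|` W2).
Proof.
move=> [y1 [V1 [y10 y1m s1 P1 c1]]] [y2 [V2 [y20 y2m s2 P2 c2]]].
(* The two index tests differ: at [m1] the vertex is taken from the first chain, the link from the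
   second. *)
exists (fun j => if (j <= m1)%N then y1 j else y2 (j - m1)%N).
exists (fun j => if (j < m1)%N then V1 j else V2 (j - m1)%N).
split => //.
- case: leqP => [m2l|]; last by rewrite addKn.
  have m20 : m2 = 0%N by lia.
  by move: y2m; rewrite m20 y20 addn0 y1m.
- move=> j jm; case: (ltngtP j m1) jm => [jm1|jm1|->] jm.
  + by have := s1 _ jm1.
  + by rewrite subSn ?(ltnW jm1) //; apply: s2; lia.
  + by rewrite subSnn subnn y1m -y20; apply: s2; lia.
- by move=> j jm; case: leqP => [/P1//|jm1]; apply: P2; lia.
- move=> z [/c1|/c2] [j /= jm Vz].
    by exists j => /=; [lia|rewrite jm].
  by exists (m1 + j)%N => /=; [lia|rewrite ltnNge leq_addr /= addKn].
Qed.

Lemma chain_sub e P m p q W W' : W' `<=` W ->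
  chain e P m p q W -> chain e P m p q W'.
Proof.
move=> WW [y [V [? ? ? ? c]]]; exists y, V; split => //.
exact: subset_trans c.
Qed.

Lemma chain0 e (P : set X) p : P p -> chain e P 0%N p p set0.
Proof. by move=> Pp; exists (fun=> p), (fun=> set0); split. Qed.

Lemma chain1 e (P : set X) p q N : P p -> P q -> small_link e N p q ->
  chain e P 1%N p q N.
Proof.
move=> Pp Pq sN; exists (fun j => if j is 0 then p else q), (fun=> N); split => //.
- by move=> [].
- by move=> [].
- by move=> z; exists 0%N.
Qed.

(** A chain is lengthened by links that stay at [q]. This later gives all chains of a level the same
    length. *)
Lemma chain_pad (e : R) P m m' p q W : 0 < e -> (m <= m')%N ->
  chain e P m p q W -> chain e P m' p q W.
Proof.
move=> e0 /subnKC <-; elim: (m' - m)%N => [|k IH] ch; first by rewrite addn0.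
have {}IH := IH ch; rewrite addnS -addn1.
have Pq : P q by have [y [V [_ <- _ Py _]]] := ch; exact: Py.
have [N [oN Nq] [cN dN']] := small_nbhs q e0.
by apply: chain_sub (chain_cat IH (@chain1 _ _ _ _ N _ _ _)) => // z; left.
Qed.

(** The set [B] of points reachable from [p] is relatively open and closed in [P], because any two
    points of [P] in a common [N x] are joined by a single link. *)
Lemma connected_chain (e : R) P p q : 0 < e -> connected P -> P p -> P q ->
  exists m, chain e P m p q set0.
Proof.
move=> e0 cP Pp Pq.
have [N oN sN] := small_nbhs_family e0.
pose B := [set x | P x /\ exists m, chain e P m p x set0].
have ext x u v : P u -> P v -> N x u -> N x v -> B u -> B v.
  move=> Pu Pv Nu Nv [_ [m ch]]; split=> //; exists (m + 1)%N.
  apply: chain_sub (chain_cat ch (@chain1 _ _ _ _ (N x) _ _ _)) => //.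
  by split=> //; apply sN.
suff BP : B = P by have [] : B q by rewrite BP.
apply: cP.
- by exists p; split=> //; exists 0%N; exact: chain0.
- exists (\bigcup_(x in B) N x).
    by apply: bigcup_open => x _; apply oN.
  apply/seteqP; split=> [x Bx|x [Px [b Bb Nbx]]].
    by split; [case: Bx|exists x => //; apply oN].
  by apply: (ext b b x) => //; [case: Bb|apply oN].
- exists (~` \bigcup_(x in P `\` B) N x).
    by rewrite closedC; apply: bigcup_open => x _; apply oN.
  apply/seteqP; split=> [x Bx|x [Px nx]].
    split; first by case: Bx.
    move=> [b [Pb nBb] Nbx]; apply: nBb.
    by apply: (ext b x b) => //; [case: Bx|apply oN].
  by apply: contrapT => nBx; apply: nx; exists x => //; apply oN.
Qed.

(** Finitely many [N x] cover the space. The chain visits in turn each one that meets [P], inserts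
    it as a link from a point of [P] to itself, and finally goes to [q]. *)
Lemma connected_covering_chain (e : R) P p q : 0 < e -> connected P -> P p -> P q ->
  exists m, chain e P m p q P.
Proof.
move=> e0 cP Pp Pq.
have [N oN sN] := small_nbhs_family e0.
have [s sc] := compact_finite_nbhs_cover cX (fun x => open_nbhs_nbhs (oN x)).
suff [m ch] : exists m, chain e P m p q (P `&` \bigcup_(x in [set` s]) N x).
  exists m; apply: chain_sub ch => z Pz.
  by split; last exact: sc.
elim: s p Pp {sc} => [|x s IH] p Pp.
  have [m ch] := connected_chain e0 cP Pp Pq; exists m.
  by apply: chain_sub ch => z [_ [x]].
have [[v [Pv Nv]]|nPN] := pselect (P `&` N x !=set0); last first.
  have [m ch] := IH _ Pp; exists m; apply: chain_sub ch => z [Pz [y]] /=.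
  rewrite in_cons => /orP[/eqP->Nz|ys Nz].
    by exfalso; apply: nPN; exists z.
  by split=> //; exists y.
have [m1 ch1] := connected_chain e0 cP Pp Pv.
have [m2 ch2] := IH _ Pv.
have ch : chain e P 1%N v v (N x).
  by apply: chain1 => //; split=> //; apply sN.
exists ((m1 + 1) + m2)%N.
apply: chain_sub (chain_cat (chain_cat ch1 ch) ch2) => z [Pz [y]] /=.
rewrite in_cons => /orP[/eqP->Nz|ys Nz]; first by left; right.
by right; split=> //; exists y.
Qed.


(* [k] links with vertices [x 0, ..., x k], the [i]-th one inside [V i] *)
Definition level : Type := nat * (nat -> X) * (nat -> set X).

(** * Successive refinement of chains covering the space *)

Definition good_level (n : nat) (L : level) :=
  let: (k, x, V) := L in
  [/\ (0 < k)%N, forall i, (i < k)%N -> small_link (eps n) (V i) (x i) (x i.+1)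
    & forall z, exists2 i, (i < k)%N & V i z].

(** Every link is cut into the same number [m] of links, so [j %/ m] is the index of the parent of
    [j]; the last index [k * m] has parent [k]. *)
Definition refines (n : nat) (L L' : level) :=
  let: (k, x, V) := L in let: (k', y, V') := L' in
  exists m, [/\ (0 < m)%N, k' = (k * m)%N &
    forall j, (j <= k * m)%N -> d (x (j %/ m)%N) (y j) <= eps n].

Lemma uniform_chains n k (x : nat -> X) (V : nat -> set X) :
  (forall i, (i < k)%N -> small_link (eps n) (V i) (x i) (x i.+1)) ->
  exists2 M, (0 < M)%N & forall i, (i < k)%N ->
    chain (eps n.+1) (V i) M (x i) (x i.+1) (V i).
Proof.
elim: k => [|k IH] sV; first by exists 1%N.
have [|M M0 cM] := IH; first by move=> i ik; apply: sV; exact: ltnW.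
have [cV _ Vx Vx'] := sV k (ltnSn k).
have [m cm] := connected_covering_chain (eps_gt0 n.+1) cV Vx Vx'.
exists (M + m)%N; first by rewrite addn_gt0 M0.
move=> i; rewrite ltnS leq_eqVlt => /orP[/eqP->|/cM ch].
  by apply: chain_pad cm; [exact: eps_gt0|exact: leq_addl].
by apply: chain_pad ch; [exact: eps_gt0|exact: leq_addr].
Qed.

Lemma refine_level n (L : level) : good_level n L ->
  exists L', good_level n.+1 L' /\ refines n L L'.
Proof.
case: L => [[k x] V] [k0 sV cV].
have [M M0 chM] := uniform_chains sV.
have /choice[f hf] i : exists f : (nat -> X) * (nat -> set X), (i < k)%N ->
    [/\ f.1 0%N = x i, f.1 M = x i.+1,
    forall j, (j < M)%N -> small_link (eps n.+1) (f.2 j) (f.1 j) (f.1 j.+1),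
    forall j, (j <= M)%N -> V i (f.1 j) & V i `<=` \bigcup_(j in `I_M) f.2 j].
  have [ik|_] := ltnP i k; last by exists (x, V).
  by have [y [W hyW]] := chM i ik; exists (y, W).
(* At [j = k * M] the quotient is [k], which indexes no link, so the last vertex is set
   separately. *)
pose y j := if (j < k * M)%N then (f (j %/ M)%N).1 (j %% M)%N else x k.
pose W j := (f (j %/ M)%N).2 (j %% M)%N.
(* The case [r = M] is included: the chain of link [i] ends where that of link [i.+1] starts. *)
have yE i r : (i < k)%N -> (r <= M)%N -> y (i * M + r)%N = (f i).1 r.
  move=> ik; rewrite leq_eqVlt => /orP[/eqP ->|rM].
    have [_ -> _ _ _] := hf i ik.
    rewrite addnC -mulSn /y ltn_mul2r M0 /= mulnK // modnMl.
    case: ltnP => [ik'|ki]; first by have [-> _ _ _ _] := hf _ ik'.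
    by congr x; apply/eqP; rewrite eqn_leq ki.
  rewrite /y divnMDl // modnMDl divn_small // modn_small // addn0 ifT //.
  by apply: (@leq_trans (i * M + M)%N); rewrite ?ltn_add2l // addnC -mulSn leq_mul2r ik orbT.
have WE i r : (r < M)%N -> W (i * M + r)%N = (f i).2 r.
  by move=> rM; rewrite /W divnMDl // modnMDl divn_small // modn_small // addn0.
exists ((k * M)%N, y, W); split; [split|].
- by rewrite muln_gt0 k0.
- move=> j jkM; have ik : (j %/ M < k)%N by rewrite ltn_divLR.
  have rM : (j %% M < M)%N by rewrite ltn_mod.
  rewrite (divn_eq j M) -addnS !yE ?WE ?(ltnW rM) //.
  by have [_ _ + _ _] := hf _ ik; exact.
- move=> z; have [i ik Vz] := cV z.
  have [_ _ _ _ /(_ z Vz)[r /= rM fz]] := hf i ik.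
  exists (i * M + r)%N; last by rewrite WE.
  by apply: (@leq_trans (i * M + M)%N); rewrite ?ltn_add2l // addnC -mulSn leq_mul2r ik orbT.
- exists M; split=> // j; rewrite leq_eqVlt => /orP[/eqP->|jkM].
    by rewrite mulnK // /y ltnn metric_refl ltW // eps_gt0.
  have ik : (j %/ M < k)%N by rewrite ltn_divLR.
  have rM : (j %% M <= M)%N by rewrite ltnW // ltn_mod.
  rewrite {2}(divn_eq j M) yE //; apply: ltW.
  have [_ _ _ Vf _] := hf _ ik; have [_ dV Vx _] := sV _ ik.
  by apply: dV => //; exact: Vf.
Qed.

Lemma exists_levels : [set: X] !=set0 -> connected [set: X] ->
  exists L : nat -> level, forall n, good_level n (L n) /\ refines n (L n) (L n.+1).
Proof.
move=> [x0 _] connX.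
have [L0 gL0] : exists L, good_level 0 L.
  have [m [x [V [_ _ sV _ cV]]]] :=
    connected_covering_chain (eps_gt0 0) connX (I : [set: X] x0) (I : [set: X] x0).
  exists (m, x, V); split => //; last first.
    by move=> z; have [i] := cV z I; exists i.
  by have [i /= im _] := cV x0 I; exact: leq_ltn_trans im.
have /choice[F hF] (nL : nat * level) : exists L', good_level nL.1 nL.2 ->
    good_level nL.1.+1 L' /\ refines nL.1 nL.2 L'.
  have [/refine_level[L' hL']|ng] := pselect (good_level nL.1 nL.2).
    by exists L'.
  by exists nL.2.
pose L := fix L n := if n is n'.+1 then F (n', L n') else L0.
have gL n : good_level n (L n).
  by elim: n => [|n IH] //=; have [] := hF (n, L n) IH.
by exists L => n; split=> //; have [] := hF (n, L n) (gL n).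
Qed.

(** * The limit of the chains as a surjection from the unit interval *)

(** This makes the index of a parameter at one level the parent of its index at the next. *)
Lemma truncn_mul_divn (a : R) (m : nat) : 0 <= a -> (0 < m)%N ->
  (Num.truncn (a * m%:R) %/ m)%N = Num.truncn a.
Proof.
move=> a0 m0; have am0 : 0 <= a * m%:R by rewrite mulr_ge0.
have m0' : 0 < m%:R :> R by rewrite ltr0n.
have /andP[h1 h2] := truncn_itv am0; have /andP[h3 h4] := truncn_itv a0.
set t := Num.truncn (a * _) in h1 h2 *; set s := Num.truncn a in h3 h4 *.
have lo : (s * m < t.+1)%N.
  rewrite -(ltr_nat R) natrM; apply: le_lt_trans h2.
  by rewrite ler_pM2r.
have hi : (t < s.+1 * m)%N.
  rewrite -(ltr_nat R) natrM; apply: le_lt_trans h1 _.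
  by rewrite ltr_pM2r.
apply/eqP; rewrite eqn_leq -ltnS ltn_divLR // hi /= leq_divRL //.
Qed.

(** [g t] is the limit of the vertices of index [idx n t], the integer part of [t * k n]. Uniform
    continuity is phrased with [1 / k] because [k] later counts arcs; values of [g] outside the unit
    interval are arbitrary. *)
Lemma hahn_mazurkiewicz : [set: X] !=set0 -> connected [set: X] ->
  exists g : R -> X,
    (forall e : R, 0 < e -> exists2 k : nat, (0 < k)%N & forall s t,
       0 <= s <= 1 -> 0 <= t <= 1 -> `|s - t| <= k%:R^-1 -> d (g s) (g t) < e) /\
    (forall x, exists2 t, 0 <= t <= 1 & g t = x).
Proof.
move=> X0 connX; have [L hL] := exists_levels X0 connX.
pose k n := (L n).1.1; pose x n := (L n).1.2; pose V n := (L n).2.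
have gL n : [/\ (0 < k n)%N,
    forall i, (i < k n)%N -> small_link (eps n) (V n i) (x n i) (x n i.+1)
    & forall z, exists2 i, (i < k n)%N & V n i z].
  by rewrite /k /x /V; have [] := hL n; case: (L n) => [[? ?] ?].
have rL n : exists m, [/\ (0 < m)%N, k n.+1 = (k n * m)%N &
    forall j, (j <= k n * m)%N -> d (x n (j %/ m)%N) (x n.+1 j) <= eps n].
  by rewrite /k /x; have [_] := hL n; case: (L n) => [[? ?] ?]; case: (L n.+1) => [[? ?] ?].
have k0 n : (0 : R) < (k n)%:R by rewrite ltr0n; have [] := gL n.
pose idx n (t : R) := Num.truncn (t * (k n)%:R).
have idx_itv n t : 0 <= t -> (idx n t)%:R <= t * (k n)%:R < (idx n t).+1%:R.
  by move=> t0; apply: truncn_itv; rewrite mulr_ge0 // ltW.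
have idx_le n t : 0 <= t <= 1 -> (idx n t <= k n)%N.
  move=> /andP[t0 t1]; have /andP[h _] := idx_itv n t t0.
  rewrite -(ler_nat R); apply: le_trans h _.
  by rewrite ler_piMl // ltW.
have /choice[g hg] t : exists l, 0 <= t <= 1 -> forall n, d (x n (idx n t)) l <= 3 * eps n.
  have [t01|] := boolP (0 <= t <= 1); last by have [p _] := X0; exists p.
  have [|l hl] := @metric_geometric_cvg (fun n => x n (idx n t)) cX; last by exists l.
  move=> n; have [m [m0 km dm]] := rL n.
  have -> : idx n t = (idx n.+1 t %/ m)%N.
    rewrite /idx km natrM mulrA truncn_mul_divn //.
    by case/andP: t01 => t0 _; rewrite mulr_ge0 // ltW.
  by apply: dm; rewrite -km idx_le.
have adj n i j : (i <= j <= i.+1)%N -> (j <= k n)%N -> d (x n i) (x n j) <= eps n.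
  move=> /andP[ij ji] jk; have [_ sV _] := gL n.
  have [->|ji'] : j = i \/ j = i.+1 by lia.
    by rewrite metric_refl ltW // eps_gt0.
  have [|_ dV Vi Vi'] := sV i; first by lia.
  by rewrite ji' ltW // dV.
(* Parameters at most [1 / k n] apart have equal or consecutive indices, so their vertices are
   within [eps n]; passing to the limits costs [3 * eps n] at each end. *)
have gN n s t : 0 <= s <= 1 -> 0 <= t <= 1 -> s <= t -> t - s <= (k n)%:R^-1 ->
    d (g s) (g t) <= 7 * eps n.
  move=> s01 t01 st dst; have /andP[s0 s1] := s01; have /andP[t0 t1] := t01.
  have /andP[h1 h2] := idx_itv n s s0; have /andP[h3 h4] := idx_itv n t t0.
  have tk : t * (k n)%:R <= s * (k n)%:R + 1.
    have := ler_wpM2r (ltW (k0 n)) dst; rewrite mulVf ?gt_eqF // mulrBl; lra.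
  have stk : s * (k n)%:R <= t * (k n)%:R by rewrite ler_pM2r.
  have lo : (idx n s < (idx n t).+1)%N by rewrite -(ltr_nat R); lra.
  have hi : (idx n t < (idx n s).+2)%N.
    rewrite -(ltr_nat R) -((natr1 (idx n s).+1)); lra.
  have := adj n (idx n s) (idx n t); rewrite -ltnS lo -ltnS hi idx_le // => /(_ isT isT).
  have := hg s s01 n; have := hg t t01 n.
  have := dD (g s) (x n (idx n s)) (g t); have := dD (x n (idx n s)) (x n (idx n t)) (g t).
  by rewrite (dC (g s) (x n _)); lra.
have gU e : 0 < e -> exists2 k : nat, (0 < k)%N & forall s t,
       0 <= s <= 1 -> 0 <= t <= 1 -> `|s - t| <= k%:R^-1 -> d (g s) (g t) < e.
  move=> e0; have e70 : 0 < e / 7 by lra.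
  have [n en] := eps_small e70; exists (k n); first by have [] := gL n.
  have en7 : 7 * eps n < e by lra.
  move=> s t s01 t01 st; apply: le_lt_trans en7.
  have [le_st|/ltW le_ts] := leP s t.
    by apply: gN => //; rewrite distrC ger0_norm ?subr_ge0 in st.
  by rewrite dC; apply: gN => //; rewrite ger0_norm ?subr_ge0 in st.
exists g; split=> // z.
(* At each level [z] lies in some link [i n]; a cluster point of the parameters [i n / k n] is
   mapped to [z]. *)
have /choice[i hi] n : exists i, (i < k n)%N /\ V n i z.
  by have [_ _ /(_ z)[i]] := gL n; exists i.
pose t n : R := (i n)%:R / (k n)%:R.
have t01 n : 0 <= t n <= 1.
  rewrite /t divr_ge0 //= ler_pdivrMr // mul1r ler_nat ltnW //.
  by have [] := hi n.
have dgz n : d (g (t n)) z <= 4 * eps n.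
  have := hg _ (t01 n) n; rewrite /idx /t divfK ?gt_eqF // natrK.
  have [_ sV _] := gL n; have [ik Viz] := hi n; have [_ dV Vx _] := sV _ ik.
  have := dV _ _ Vx Viz; have := dD (g (t n)) (x n (i n)) z.
  by rewrite /t (dC (g _) (x n _)); lra.
have [|l [l01 cl]] := @segment_compact R 0 1 (t @ \oo) _.
  by exists 0%N => // n _ /=; rewrite in_itv /= t01.
have {}l01 : 0 <= l <= 1 by move: l01; rewrite /= in_itv.
exists l => //; apply: metric_small_eq => e e0.
have e20 : 0 < e / 2 by lra.
(* Uniform continuity accounts for [e / 2], and [4 * eps m < e / 2] for the rest. *)
have [K K0 hK] := gU _ e20; have e80 : 0 < e / 8 by lra.
have [n0 en0] := eps_small e80.
have lK : nbhs l (ball l K%:R^-1) by apply: nbhsx_ballx; rewrite invr_gt0 ltr0n.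
have [|_ [[m /= nm <-] ltm]] := cl (t @` [set m | (n0 <= m)%N]) _ _ lK.
  by exists n0 => // m /= nm; exists m.
have := hK _ _ l01 (t01 m) (ltW ltm); have := dgz m.
have : eps m <= eps n0 by apply: ler_wiXn2l => //; rewrite ?invr_ge0 // invf_le1 // ler1n.
have := dD (g l) (g (t m)) z; lra.
Qed.

End Chains.
End MetricPeano.

(** * Extending the fractal structure *)

HB.instance Definition _ (T : Type) := Monoid.isLaw.Build (T -> T) idfun
  (@comp T T T) (fun _ _ _ => erefl) (fun _ => erefl) (fun _ => erefl).

(** A letter from [G1] followed by any letter gives a constant map. The extra [h] supplies that next
    letter when the one from [G1] is outermost. *)
Lemma comp_word_constant (T : Type) (G0 G1 : set (T -> T)) n (f : 'I_n -> T -> T) :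
  (forall h g, (G0 `|` G1) h -> G1 g -> constant_on (h \o g) [set: T]) ->
  (forall i, (G0 `|` G1) (f i)) ->
  (forall i, G0 (f i)) \/
  (forall h, (G0 `|` G1) h ->
     constant_on (h \o \big[comp/idfun]_(i < n) f i) [set: T]).
Proof.
move=> hG; elim: n f => [|n IH] f Gf; first by left=> -[].
rewrite big_ord_recl; have [G0f|cst] := IH (fun i => f (lift ord0 i)) (fun=> Gf _).
  have [G0f0|G1f0] := Gf ord0; last first.
    by right=> h Gh x y _ _; exact: (hG h _ Gh G1f0).
  by left=> i; case: (unliftP ord0 i) => [j|] ->.
by right=> h Gh x y _ _ /=; congr h; exact: cst.
Qed.

Lemma comp_semiconj (T T' : Type) (v : T -> T') n (f : 'I_n -> T' -> T')
    (f' : 'I_n -> T -> T) :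
  (forall i a, f i (v a) = v (f' i a)) ->
  forall a, (\big[comp/idfun]_(i < n) f i) (v a) =
            v ((\big[comp/idfun]_(i < n) f' i) a).
Proof.
move=> ff' a; elim: n f f' ff' => [|n IH] f f' ff'; first by rewrite !big_ord0.
rewrite !big_ord_recl /= (IH _ (fun i => f' (lift ord0 i))) //.
Qed.

Lemma near_finite_forall (T : topologicalType) (I : choiceType) (D : set I)
    (P : I -> set T) (x : T) : finite_set D ->
  (forall i, D i -> nbhs x (P i)) -> nbhs x [set y | forall i, D i -> P i y].
Proof.
move=> /finite_fsetP[S ->] nP; exact: filter_bigI.
Qed.

(** * Extension of self-maps of [A] by a constant *)

Section Extension.
Context (X : topologicalType) (A : set X) (b : set_type A).
Context (hX : hausdorff_space X) (cA : compact [set: set_type A]).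

(** If [b] is outside [U] and [f] is constant off [U], then [f b] is also the value of [f] on [A]
    minus [U], so the two cases agree there. *)
Definition const_ext (f : set_type A -> set_type A) (x : X) : X :=
  if pselect (A x) is left Ax then set_val (f (SigSub (mem_set Ax)))
  else set_val (f b).

Lemma const_extE f a : const_ext f (set_val a) = set_val (f a).
Proof.
rewrite /const_ext; case: pselect => [Ax|]; last by case; exact: set_valP.
by congr (set_val (f _)); apply: val_inj.
Qed.

Lemma const_ext_out f x : ~ A x -> const_ext f x = set_val (f b).
Proof. by rewrite /const_ext; case: pselect. Qed.

Lemma const_ext_range f x : A (const_ext f x).
Proof. by rewrite /const_ext; case: pselect => [Ax|_]; exact: set_valP. Qed.

Lemma const_ext_constant_on f (U : set X) : ~ U (set_val b) ->
  constant_on f (~` (set_val @^-1` U)) -> constant_on (const_ext f) (~` U).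
Proof.
move=> nUb fU; suff E x : ~ U x -> const_ext f x = set_val (f b).
  by move=> x y /E -> /E ->.
move=> nUx; have [Ax|nAx] := pselect (A x); last exact: const_ext_out.
by rewrite -[x]/(set_val (SigSub (mem_set Ax))) const_extE; congr set_val; exact: fU.
Qed.

(** The preimage of a closed set is the image of a closed, hence compact, part of [A], joined with
    the complement of [U] when the constant value lies in that closed set. *)
Lemma const_ext_continuous f (U : set X) : open U -> U `<=` A ->
  ~ U (set_val b) -> constant_on f (~` (set_val @^-1` U)) ->
  continuous f -> continuous (const_ext f).
Proof.
move=> oU UA nUb fU cf; have cval := @initial_continuous A X set_val.
have cstf := const_ext_constant_on nUb fU.
have fb : const_ext f (set_val b) = set_val (f b) := const_extE f b.
apply/continuous_closedP => D cD.
pose E := (set_val \o f) @^-1` D.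
have cE : closed (set_val @` E).
  apply: compact_closed => //; apply: continuous_compact.
    exact: continuous_subspaceT.
  apply: (subclosed_compact _ cA) => //.
  have /continuous_closedP : continuous (set_val \o f).
    by move=> a; apply: continuous_comp; [exact: cf|exact: cval].
  exact.
have -> : const_ext f @^-1` D =
    set_val @` E `|` (if pselect (D (set_val (f b))) then ~` U else set0).
  apply/seteqP; split=> x /=.
    have [Ax|nAx] := pselect (A x).
      rewrite -[x]/(set_val (SigSub (mem_set Ax))) const_extE => Dx.
      by left; exists (SigSub (mem_set Ax)).
    by rewrite const_ext_out // => Dx; right; case: pselect => //= _ /UA.
  case=> [[a Da <-]|]; first by rewrite (const_extE f a).
  case: pselect => //= Db nUx.
  by rewrite (cstf x (set_val b)) // fb.
apply: closedU => //; case: pselect => /= ?; last exact: closed0.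
exact: open_closedC.
Qed.

End Extension.

(** * From the fractal structure of [A] to one on [X] *)

Lemma fractal_of_constant_extension (X : topologicalType) (A U : set X)
    (F : set (set_type A -> set_type A)) (G1 : set (X -> X)) :
  compact_space X -> open U -> U `<=` A -> A `\` U !=set0 ->
  topological_fractal F ->
  (forall f, F f -> constant_on f (~` (set_val @^-1` U))) ->
  finite_set G1 ->
  (forall g, G1 g -> continuous g /\ constant_on g (~` U)) ->
  (forall g x, G1 g -> ~ U (g x)) ->
  (forall x, ~ A x -> exists2 g, G1 g & exists y, g y = x) ->
  underlying_space_of_topological_fractal X.
Proof.
move=> [hX cX] oU UA [x0 [Ax0 nUx0]] [[_ cA] [_ finF contF contr] surjF] cstF finG1 hG1 G1U covG1.
pose b : set_type A := SigSub (mem_set Ax0).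
have nUb : ~ U (set_val b) by [].
pose G0 := const_ext b @` F; pose G := G0 `|` G1.
have finG : finite_set G by rewrite finite_setU; split=> //; exact: finite_image.
have Gcst h : G h -> constant_on h (~` U).
  by case=> [[f Ff <-]|/hG1[]//]; apply: const_ext_constant_on => //; exact: cstF.
have Gcont h : G h -> continuous h.
  case=> [[f Ff <-]|/hG1[]//].
  by apply: (const_ext_continuous (b := b) hX cA oU) => //; [exact: cstF|exact: contF].
exists G; split=> //; last first.
  apply/seteqP; split=> // x _; have [Ax|nAx] := pselect (A x); last first.
    by have [g Gg [y <-]] := covG1 x nAx; exists g; [right|exists y].
  have [f Ff [a _ fa]] : (\bigcup_(f in F) (f @` [set: A])) (SigSub (mem_set Ax)).
    by rewrite -surjF.
  exists (const_ext b f); first by left; exists f.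
  by exists (set_val a) => //; rewrite const_extE fa.
split=> // C oC covC.
(* The outermost letter can be any [h] in the finite set [G], so members of [C'] must be sent into
   members of [C] by all of them. *)
pose C' := [set V : set A | open V /\
  forall h, G h -> exists2 W, C W & h @` (set_val @` V) `<=` W].
have [||n hn] := contr C'.
- by move=> V [].
- move=> a _; have aW h : exists W, C W /\ W (h (set_val a)).
    by have [W CW Wx] := covC (h (set_val a)) I; exists W.
  have /choice[W hW] := aW.
  pose V := [set y : A | forall h, G h -> W h (h (set_val y))].
  have nV : nbhs a V.
    apply: near_finite_forall => // h Gh; have [CW Wa] := hW h.
    have ch : continuous (h \o (set_val : A -> X)).
      move=> y; apply: continuous_comp; last exact: Gcont.
      exact: initial_continuous.
    by apply: ch; apply: open_nbhs_nbhs; split=> //; exact: oC.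
  exists V° => //; split; first exact: open_interior.
  move=> h Gh; exists (W h); first by have [] := hW h.
  by move=> _ [_ [y /interior_subset Vy <-] <-]; exact: Vy.
(* The innermost letter brings [X] into [A], the next [n] contract there, and the outermost is
   absorbed by [C']. If a letter other than the outermost is in [G1], the word is constant. *)
exists n.+2 => f Gf; rewrite big_ord_recl.
have Gh : G (f ord0) := Gf ord0.
have [|G0f|cst] := @comp_word_constant _ G0 G1 n.+1 (fun i => f (lift ord0 i)) _ (fun=> Gf _).
- move=> h g /Gcst hU G1g x y _ _; apply: hU; exact: G1U.
- have /choice[ph hph] i : exists p, F p /\ const_ext b p = f (lift ord0 i).
    by have [p Fp <-] := G0f i; exists p.
  pose ph' i := ph (widen_ord (leqnSn n) i).
  have [V [oV hV] phV] := hn ph' (fun i => (hph _).1).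
  have [W CW hW] := hV _ Gh; exists W => //; apply: subset_trans hW.
  move=> _ [x _ <-] /=; exists ((\big[comp/idfun]_(i < n.+1) f (lift ord0 i)) x) => //.
  rewrite big_ord_recr /=.
  have Ay : A (f (lift ord0 ord_max) x) by rewrite -(hph _).2; exact: const_ext_range.
  exists ((\big[comp/idfun]_(i < n) ph' i) (SigSub (mem_set Ay))).
    by apply: phV; exists (SigSub (mem_set Ay)).
  rewrite -(comp_semiconj (f := fun i => f (lift ord0 (widen_ord (leqnSn n) i)))) //.
  by move=> i a; rewrite -(hph _).2 const_extE.
- have [W CW Wx] := covC ((f ord0 \o \big[comp/idfun]_(i < n.+1) f (lift ord0 i)) x0) I.
  exists W => // _ [x _ <-].
  by rewrite (cst _ Gh x x0).
Qed.

(** * Choice of the ball and of the arcs *)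

Theorem mainTheorem1 (R : realType) (X : topologicalType) (A : set X)
    (hX : Peano_continuum R X)
    (hA : interior A !=set0)
    (hAfractal : self_regenerating_fractal (set_type A)) :
  underlying_space_of_topological_fractal X.
Proof.
have [X0 [hausX cX] connX [d [d0 dC dD dN]] lX] := hX.
have [x0 /= Ax0] := hA; have [_ regA] := hAfractal.
(* Regeneration with the whole of [A] as open set already yields compactness of [A]. *)
have clA : closed A.
  have [F _ [[_ cA] _ _]] : exists2 F : set (A -> A),
      forall f, F f -> constant_on f (~` setT) & topological_fractal F.
    apply: regA; first exact: openT.
    by exists (SigSub (mem_set (interior_subset Ax0))).
  have -> : A = set_val @` [set: A].
    apply/seteqP; split=> [x Ax|_ [a _ <-]]; last exact: set_valP.
    by exists (SigSub (mem_set Ax)).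
  apply: compact_closed => //; apply: continuous_compact => //.
  by apply: continuous_subspaceT; exact: initial_continuous.
(* If [A] is a single point, it is open and closed, hence all of [X], and the identity alone is a
   fractal structure. *)
have [[b [Ab bx0]]|nb] := pselect (exists b, A b /\ b != x0); last first.
  have A1 : A = [set x0].
    apply/seteqP; split=> [x Ax|_ ->]; last exact: interior_subset.
    by have [//|xn] := eqVneq x x0; exfalso; apply: nb; exists x.
  have AT : A = [set: X].
    apply: connX; first by exists x0; exact: interior_subset.
      exists A°; first exact: open_interior.
      rewrite setTI; apply/seteqP; split; last exact: interior_subset.
      by move=> x; rewrite {1}A1 => ->.
    by exists A; rewrite ?setTI.
  have Xx0 x : x = x0 by have : [set: X] x by []; rewrite -AT A1.
  exists [set id]; split=> //.
    split=> // [f -> x|C oC covC]; first exact: cvg_id.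
    exists 0%N => f _; have [V CV Vx] := covC x0 I; exists V => //.
    by move=> x _; rewrite (Xx0 x).
  by apply/seteqP; split=> // x _; exists id => //; exists x.
(* The ball [U] of radius [r] omits [b]; the margin up to [2 * r] keeps arcs of diameter below [r]
   that leave [A] away from [U]. *)
have [r [r0 rA rb]] : exists r, [/\ 0 < r, [set y | d x0 y < 2 * r] `<=` A & r <= d x0 b].
  have /dN[e e0 eA] : nbhs x0 A by exact: Ax0.
  have db0 : 0 < d x0 b.
    rewrite lt_neqAle metric_ge0 // andbT eq_sym.
    by apply: contraNneq bx0 => /d0 ->.
  exists (Num.min (e / 2) (d x0 b)); split.
  - by rewrite lt_min db0 andbT divr_gt0.
  - move=> y /= dy; apply: eA => /=; apply: lt_le_trans dy _.
    by rewrite mulrC -ler_pdivlMr // ge_min lexx.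
  - by rewrite ge_min lexx orbT.
have cd : continuous (fun x => d x0 x : R^o) by exact: metric_continuous.
pose U := [set y | d x0 y < r].
have oU : open U.
  have -> : U = (fun x => d x0 x : R^o) @^-1` [set t | t < r] by [].
  by apply: open_comp; [move=> x _; exact: cd|exact: open_lt].
have UA : U `<=` A by rewrite /U => y /= dy; apply: rA => /=; lra.
have [F cstF fracF] : exists2 F : set (A -> A),
    forall f, F f -> constant_on f (~` (set_val @^-1` U)) & topological_fractal F.
  apply: regA.
    by apply: open_comp => // x _; exact: initial_continuous.
  exists (SigSub (mem_set (interior_subset Ax0))) => /=.
  by rewrite /U /= /set_val /= metric_refl.
have [g [gU gsurj]] := hahn_mazurkiewicz d0 dC dD dN cX lX X0 connX.
have [N N0 gN] := gU _ r0.
(* A tent function with value 1 at [x0] and 0 off [U]; connectedness makes it onto the unit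
   interval. *)
pose u x : R^o := Num.max 0 (1 - d x0 x / r).
have cu : continuous u.
  move=> x; apply: (@continuous_max _ _ (fun=> 0) (fun y => 1 - d x0 y / r)).
    exact: cvg_cst.
  apply: cvgB; first exact: cvg_cst.
  by apply: cvgM; [exact: cd|exact: cvg_cst].
have u01 x : 0 <= u x <= 1.
  rewrite /u le_max lexx /= ge_max ler01 /= lerBlDr lerDl.
  by rewrite divr_ge0 ?(ltW r0) // metric_ge0.
have uU x : ~ U x -> u x = 0.
  move=> /negP; rewrite -leNgt => rx; apply/max_idPl.
  by rewrite subr_le0 ler_pdivlMr // mul1r.
have usurj s : 0 <= s <= 1 -> exists y, u y = s.
  move=> /andP[s0 s1].
  have : is_interval (u @` [set: X]).
    apply/connected_intervalP; apply: connected_continuous_connected => //.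
    exact: continuous_subspaceT.
  move=> /(_ 0 1) h; have [||//|y _ <-] := h _ _ s; last by exists y.
  - by exists b => //; apply: uU; apply/negP; rewrite -leNgt.
  - exists x0 => //; rewrite /u metric_refl // mul0r subr0.
    by apply/max_idPr; exact: ler01.
  - by rewrite s0.
have NR : 0 < N%:R :> R by rewrite ltr0n.
have arg01 k (s : R) : (k < N)%N -> 0 <= s <= 1 -> 0 <= (k%:R + s) / N%:R <= 1.
  move=> kN /andP[s0 s1]; apply/andP; split.
    by rewrite divr_ge0 ?ler0n // addr_ge0.
  rewrite ler_pdivrMr // mul1r; have : (k.+1%:R : R) <= N%:R by rewrite ler_nat.
  by rewrite -natr1; lra.
(* Each arc is run through by [u]; only arcs missing [U] entirely are kept. *)
pose G1 := (fun k x => g ((k%:R + u x) / N%:R)) @`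
  [set k | (k < N)%N /\ forall s, 0 <= s <= 1 -> ~ U (g ((k%:R + s) / N%:R))].
apply: (@fractal_of_constant_extension X A U F G1) => //.
- by exists b; split=> //; apply/negP; rewrite -leNgt.
- by apply: finite_image; apply: sub_finite_set (finite_II N) => k [].
- move=> _ [k [kN kU] <-]; split; last by move=> x y /uU ux /uU uy; rewrite ux uy.
  move=> x V /dN[e e0 eV]; have [K K0 hK] := gU e e0.
  have K0' : 0 < K%:R^-1 :> R by rewrite invr_gt0 ltr0n.
  have /cvgrPdist_lt/(_ _ K0') := cu x; apply: filterS => y uxy.
  apply: eV => /=; apply: hK; [exact: arg01|exact: arg01|].
  rewrite -mulrBl opprD addrACA subrr add0r normrM (@ger0_norm _ N%:R^-1) ?invr_ge0 //.
  rewrite ler_pdivrMr //; apply: le_trans (ltW uxy) _.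
  by rewrite ler_peMr ?(ltW K0') // ler1n.
- by move=> _ x [k [kN kU] <-]; exact: kU.
move=> x nAx; have [t /andP[t0 t1] gt] := gsurj x.
have [k [s [kN s01 ts]]] : exists k s, [/\ (k < N)%N, 0 <= s <= 1 & t = (k%:R + s) / N%:R].
  have [t1'|t1'] := ltP t 1.
    have /andP[h1 h2] := truncn_itv (mulr_ge0 t0 (ltW NR)).
    set k := Num.truncn _ in h1 h2.
    exists k, (t * N%:R - k%:R); split.
    - rewrite -(ltr_nat R); apply: le_lt_trans h1 _; by rewrite gtr_pMl.
    - by rewrite -natr1 in h2; apply/andP; split; lra.
    - by rewrite addrC subrK mulfK // gt_eqF.
  (* The parameter 1 is the right end of the last arc. *)
  exists N.-1, 1; rewrite natr1 prednK // divff ?gt_eqF //; split.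
  - exact: leqnn.
  - by rewrite ler01 lexx.
  - by apply/eqP; rewrite eq_le t1 t1'.
have [y uy] := usurj s s01.
exists (fun x => g ((k%:R + u x) / N%:R)); last by exists y; rewrite uy -ts.
(* A point of this arc in [U] would put [x] within [2 * r] of [x0], hence in [A]. *)
exists k => //; split=> // s' s'01 Us'; apply: nAx; apply: rA => /=.
have : d (g ((k%:R + s') / N%:R)) (g t) < r.
  rewrite ts; apply: gN; [exact: arg01|exact: arg01|].
  rewrite -mulrBl opprD addrACA subrr add0r normrM (@ger0_norm _ N%:R^-1) ?invr_ge0 //.
  rewrite ler_piMl ?invr_ge0 // ler_norml.
  by case/andP: s01 => ? ?; case/andP: s'01 => ? ?; apply/andP; split; lra.
rewrite gt; move: Us'; rewrite /U /=.
have := dD x0 (g ((k%:R + s') / N%:R)) x; lra.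
Qed.
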